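(* Let $q$ be a prime power. For all integers $n \ge 3$ and $2 \le i \le n$, the $i$-th Whitney number of $\mathcal{H}(q,n,n-2)$ is given by \begin{multline*} (-1)^i w_i(q,n,n-2)= \begin{bmatrix} n \\ i \end{bmatrix}_q q^{\binom{i}{2}} - \left((q-1)^{n-1} + n(q-1)^{n-2}\right) \begin{bmatrix} n-1 \\ i-1 \end{bmatrix}_q q^{\binom{i-1}{2}} \\ + \left((q-1)^{n-1} \prod_{j=2}^{n-2} (q-j)\right) \begin{bmatrix} n-2 \\ i-2 \end{bmatrix}_q q^{\binom{i-2}{2}}. \end{multline*}
   Context: $\begin{bmatrix} r\\ s\end{bmatrix}_q$ is the $q$-binomial coefficient ($0$ if $s<0$ or $s>r$); an empty product is $1$. The Hamming weight of $v \in \mathbb{F}_q^n$ is the number of its nonzero coordinates. For integers $n,d\ge 1$, the higher-weight Dowling lattice $\mathcal{H}(q,n,d)$ is the set, ordered by inclusion, of all $\mathbb{F}_q$-linear subspaces of $\mathbb{F}_q^n$ that have a basis made of vectors of Hamming weight at most $d$, together with the zero space. It is a finite geometric lattice whose rank function is the $\mathbb{F}_q$-dimension. With $\mu$ the Möbius function of $\mathcal{H}(q,n,d)$, the $i$-th Whitney number (of the first kind) is $w_i(q,n,d)=\sum_{U \in \mathcal{H}(q,n,d),\ \dim U=i} \mu(\{0\},U)$. *)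

(* Defs.v *)
From HB Require Import structures.
From mathcomp Require Import all_boot all_order all_algebra.

Set Implicit Arguments.
Unset Strict Implicit.
Unset Printing Implicit Defensive.

Import Order.TTheory GRing.Theory Num.Theory.
Local Open Scope ring_scope.

Section FiniteVspace.
Variables (F : finFieldType) (vT : vectType F).

HB.instance Definition _ : isCountable {vspace vT} :=
  CanIsCountable (@VectorInternalTheory.vs2mxK F vT).
HB.instance Definition _ : isFinite {vspace vT} :=
  CanIsFinite (@VectorInternalTheory.vs2mxK F vT).

End FiniteVspace.

Section Mobius.
Context {disp : Order.disp_t} {T : finPOrderType disp}.
Implicit Types x y : T.

(* mobius x y = 0 unless x <= y: the sum is then empty. The argument k is
   fuel; #|T| steps are enough, as mobius_neq shows. *)
Fixpoint mobius_rec (k : nat) (x y : T) : int :=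
  if k is k'.+1 then
    if x == y then 1
    else - \sum_(z : T | (x <= z)%O && (z < y)%O) mobius_rec k' x z
  else 0.

Definition mobius (x y : T) : int := mobius_rec #|T| x y.

Lemma mobius_rec_stable k l x y :
  (#|[set z : T | (z <= y)%O]| <= k)%N -> (#|[set z : T | (z <= y)%O]| <= l)%N ->
  mobius_rec k x y = mobius_rec l x y.
Proof.
have pos (t : T) : (0 < #|[set z : T | (z <= t)%O]|)%N.
  by apply/card_gt0P; exists t; rewrite inE lexx.
elim: k l y => [|k IHk] [|l] y //.
- by move=> /(leq_trans (pos y)).
- by move=> _ /(leq_trans (pos y)).
move=> lek lel /=; case: eqP => // _; congr (- _).
apply: eq_bigr => z /andP[_ ltzy].
have lt : (#|[set t : T | (t <= z)%O]| < #|[set t : T | (t <= y)%O]|)%N.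
  apply/proper_card/properP; split.
    by apply/subsetP=> t; rewrite !inE => /le_trans; apply; exact: ltW.
  by exists y; rewrite inE ?lexx // lt_geF.
by apply: IHk; rewrite -ltnS; apply: leq_trans lt _.
Qed.

Lemma mobiusxx x : mobius x x = 1.
Proof.
rewrite /mobius; have : (0 < #|T|)%N by apply/card_gt0P; exists x.
by case: #|T| => //= k _; rewrite eqxx.
Qed.

Lemma mobius_neq x y : x != y ->
  mobius x y = - \sum_(z : T | (x <= z)%O && (z < y)%O) mobius x z.
Proof.
move=> neq; rewrite {1}/mobius (@mobius_rec_stable _ #|T|.+1) ?max_card //=.
  by rewrite (negPf neq).
exact: leq_trans (max_card _) _.
Qed.

End Mobius.

Section HigherWeightDowling.
Variables (F : finFieldType) (n d : nat).

Definition hamming_weight (v : 'rV[F]_n) : nat := #|[set j | v 0 j != 0]|.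

Definition in_dowling (U : {vspace 'rV[F]_n}) : bool :=
  (U == 0%VS) ||
  [exists b : (\dim U).-tuple 'rV[F]_n,
     basis_of U b && all (fun v => (hamming_weight v <= d)%N) b].

Record dowling := Dowling { dowling_space :> {vspace 'rV[F]_n};
                            dowlingP : in_dowling dowling_space }.

HB.instance Definition _ := [isSub for dowling_space].
HB.instance Definition _ := [Finite of dowling by <:].

Definition dowling_le (U V : dowling) : bool := (U <= V)%VS.

Fact dowling_le_refl : reflexive dowling_le.
Proof. by move=> U; exact: subvv. Qed.

Fact dowling_le_anti : antisymmetric dowling_le.
Proof. by move=> U V UV; apply/val_inj/eqP; rewrite eqEsubv. Qed.

Fact dowling_le_trans : transitive dowling_le.
Proof. by move=> V U W; exact: subv_trans. Qed.

Fact dowling_display : Order.disp_t. Proof. exact: Order.Disp tt tt. Qed.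

HB.instance Definition _ := Order.Le_isPOrder.Build dowling_display dowling
  dowling_le_refl dowling_le_anti dowling_le_trans.

Fact in_dowling0 : in_dowling 0%VS. Proof. by rewrite /in_dowling eqxx. Qed.

Definition dowling0 : dowling := Dowling in_dowling0.

Definition whitney (i : nat) : int :=
  \sum_(U : dowling | \dim U == i) mobius dowling0 U.

End HigherWeightDowling.

Arguments whitney : clear implicits.

(* The truncated subtraction r - j is harmless: for s > r the factor j = r
   vanishes, which gives the convention that the coefficient is then 0. *)
Definition qbinom (q : rat) (r s : nat) : rat :=
  \prod_(j < s) ((q ^+ (r - j) - 1) / (q ^+ j.+1 - 1)).

(* Main.v *)
Require Import Defs.
From mathcomp Require Import all_boot all_order all_algebra all_field.
From mathcomp Require Import ring zify.

Set Implicit Arguments.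
Unset Strict Implicit.
Unset Printing Implicit Defensive.

Import Order.TTheory GRing.Theory Num.Theory.
Local Open Scope ring_scope.

(** Regard a subspace [W] of [F^n] as a linear code.  The members of the
    higher-weight Dowling lattice below [W] are exactly those below the span of
    the vectors of [W] of weight at most [d], so the Moebius function of the
    Dowling lattice sums over them to 1 if [W] has no nonzero vector of weight at
    most [d], and to 0 otherwise ([sum_mobius_dowling]).  Thus, extended by zero
    to all subspaces, this Moebius function has as its sum function the indicator
    of the codes of minimum distance greater than [d].  Inverting this relation
    in the lattice of all subspaces, whose Moebius function takes the value
    (-1)^k q^C(k,2) on an interval of length [k], and counting the subspaces of
    dimension [i] above a given one, expresses every Whitney number as a weighted
    count of such codes by dimension ([whitney_codes]).

    For d = n - 2 the Singleton bound leaves only dimensions 0, 1 and 2, which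
    give the three terms of the formula.  The zero code accounts for the first.
    A line is such a code exactly when it is spanned by a vector with at most one zero
    coordinate ([count_good_lines]).  A plane is such a code exactly when the columns of
    any 2 x n generator matrix are pairwise independent ([minors_neq0_plane]);
    these matrices are given by [n] distinct points of the projective line and
    [n] nonzero scalars, and dividing by the number of ordered bases of a plane
    yields the last coefficient ([count_good_planes]). *)

(** * Gaussian binomials *)

Section QBinomial.
Variables (q : rat) (q_gt1 : 1 < q).

Lemma qexpr_sub1_neq0 k : q ^+ k.+1 - 1 != 0.
Proof. by rewrite subr_eq0 gt_eqF // exprn_egt1. Qed.

Lemma qbinom0 m : qbinom q m 0 = 1.
Proof. by rewrite /qbinom big_ord0. Qed.

Lemma qbinomS m r :
  qbinom q m r.+1 = qbinom q m r * ((q ^+ (m - r) - 1) / (q ^+ r.+1 - 1)).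
Proof. by rewrite /qbinom big_ord_recr. Qed.

Lemma qbinom_small m r : (m < r)%N -> qbinom q m r = 0.
Proof.
move=> ltmr; rewrite /qbinom (bigD1 (Ordinal ltmr)) //=.
by rewrite subnn expr0 subrr mul0r mul0r.
Qed.

(** The two products share all their factors but the outermost ones. *)
Lemma qbinom_succ m r :
  (q ^+ (m.+1 - r) - 1) * qbinom q m.+1 r = (q ^+ m.+1 - 1) * qbinom q m r.
Proof.
elim: r => [|r IHr]; first by rewrite !qbinom0 subn0.
have nz := qexpr_sub1_neq0 r.
rewrite subSS !qbinomS.
transitivity ((q ^+ (m - r) - 1) / (q ^+ r.+1 - 1)
   * ((q ^+ (m.+1 - r) - 1) * qbinom q m.+1 r)); first by field.
by rewrite IHr; field.
Qed.

Lemma qbinomSn r : qbinom q r.+1 r = (q ^+ r.+1 - 1) / (q - 1).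
Proof.
have qbinomnn : qbinom q r r = 1.
  elim: r => [|r IHr]; first exact: qbinom0.
  have := qbinom_succ r r; rewrite IHr subSnn expr1 qbinomS subSnn mulr1 expr1.
  by rewrite mulrA [qbinom _ _ _ * _]mulrC => ->; rewrite divff ?qexpr_sub1_neq0.
have nz : q - 1 != 0 by have := qexpr_sub1_neq0 0; rewrite expr1.
have := qbinom_succ r r; rewrite subSnn qbinomnn expr1 mulr1 => <-.
by rewrite mulrC mulrA mulVf ?mul1r.
Qed.

(** The Moebius function of the lattice of all subspaces of a finite vector
    space, on an interval of length [k]. *)
Definition mobius_coef (k : nat) : rat := (-1) ^+ k * q ^+ 'C(k, 2).

(** Stopping the alternating sum early leaves a single term, because by
    the q-Pascal rule the sum telescopes. *)
Lemma sum_mobius_coef_qbinom m R :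
  \sum_(r < R.+1) mobius_coef r * qbinom q m.+1 r =
    (-1) ^+ R * q ^+ 'C(R.+1, 2) * qbinom q m R.
Proof.
elim: R => [|R IHR]; first by rewrite big_ord1 /mobius_coef !qbinom0.
rewrite big_ord_recr IHR /= /mobius_coef.
have nz := qexpr_sub1_neq0 R.
have [leRm|ltmR] := leqP R m; last first.
  by rewrite !qbinom_small ?mulr0 ?addr0 // ltnW.
have qS : qbinom q m.+1 R.+1 =
    (q ^+ m.+1 - 1) * qbinom q m R / (q ^+ R.+1 - 1).
  by rewrite qbinomS -qbinom_succ; field.
rewrite qS qbinomS (binS R.+1) bin1 !exprD [(-1) ^+ R.+1]exprS.
have -> : q ^+ m.+1 = q ^+ (m - R) * q ^+ R.+1 by rewrite -exprD; congr (_ ^+ _); lia.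
by field.
Qed.

(** The orthogonality relation by which [mobius_coef] inverts summation over
    subspaces. *)
Lemma sum_mobius_coef m R : (m <= R)%N ->
  \sum_(r < R.+1) mobius_coef r * qbinom q m r = (m == 0)%:R.
Proof.
case: m => [_|m ltmR] /=.
  rewrite big_ord_recl big1 /= ?addr0 ?qbinom0 /mobius_coef ?mulr1 //.
  by move=> i _; rewrite qbinom_small ?mulr0.
by rewrite sum_mobius_coef_qbinom qbinom_small ?mulr0.
Qed.

End QBinomial.

(** * Counting the subspaces of an interval *)

Section Interval.
Variables (F : finFieldType) (n : nat).
Implicit Types U V W : {vspace 'rV[F]_n}.
Local Notation q := (#|F|%:R : rat).

Lemma card_field_gt1 : 1 < q.
Proof. by rewrite ltr1n card_finNzRing_gt1. Qed.
Hint Resolve card_field_gt1 : core.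

Definition subspaces_between W U r : {set {vspace 'rV[F]_n}} :=
  [set V | (W <= V <= U)%VS && (\dim V == \dim W + r)%N].

Lemma dim_fullrV : \dim {: 'rV[F]_n} = n.
Proof. by rewrite dimvf /dim /= mul1n. Qed.

Lemma dim_rV_le W : (\dim W <= n)%N.
Proof. by rewrite -[X in (_ <= X)%N]dim_fullrV dimvS ?subvf. Qed.

Lemma card_setD_vspace V U : (V <= U)%VS ->
  #|[set v in U | v \notin V]|%:R = q ^+ \dim U - q ^+ \dim V.
Proof.
move=> sVU; rewrite -!natrX -!card_vspace.
have -> : #|U| = (#|V| + #|[set v in U | v \notin V]|)%N.
  rewrite -(cardID (mem V) (mem U)); congr (_ + _)%N; apply: eq_card => v.
    by rewrite !inE; case: (boolP (v \in V)) => vV; rewrite ?andbF // (subvP sVU).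
  by rewrite !inE andbC.
by rewrite natrD addrAC subrr add0r.
Qed.

Lemma dim_add_vline V (v : 'rV[F]_n) : v \notin V -> \dim (V + <[v]>)%VS = (\dim V).+1.
Proof.
move=> vV; have v0 : v != 0 by apply: contraNneq vV => ->; rewrite mem0v.
rewrite dimv_disjoint_sum ?dim_vline ?v0 ?addn1 //.
apply/eqP; rewrite -subv0; apply/subvP => x /memv_capP[xV /vlineP[k def_x]].
rewrite memv0; apply: contraNT vV => x0.
have k0 : k != 0 by apply: contraNneq x0 => k0; rewrite def_x k0 scale0r.
by rewrite -(scalerK k0 v) -def_x rpredZ.
Qed.

(** Count in two ways the pairs of a space [V] of dimension [r] over [W] and a
    vector of [U] outside [V]: adding the vector to [V] gives a space [V'] one
    dimension larger, and the pairs giving the same [V'] are the pairs of the same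
    kind inside [V'].  The induction hypothesis thus serves for both [U] and [V']. *)
Lemma card_subspaces_between W U r : (W <= U)%VS ->
  #|subspaces_between W U r|%:R = qbinom q (\dim U - \dim W) r.
Proof.
elim: r U => [|r IHr] U sWU.
  rewrite qbinom0 (_ : subspaces_between W U 0 = [set W]) ?cards1 //.
  apply/setP => V; rewrite !inE addn0; apply/idP/eqP => [|->]; last first.
    by rewrite subvv sWU eqxx.
  by case/andP=> /andP[sWV _] /eqP dV; apply/esym/eqP; rewrite eqEdim sWV dV /=.
pose P (p : {vspace 'rV[F]_n} * 'rV[F]_n) U :=
  (p.1 \in subspaces_between W U r) && (p.2 \in [set v in U | v \notin p.1]).
have countP U' : (W <= U')%VS -> \sum_(p | P p U') 1 =
    qbinom q (\dim U' - \dim W) r * (q ^+ \dim U' - q ^+ (\dim W + r)).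
  move=> sWU'; rewrite -IHr // -(pair_big_dep (mem (subspaces_between W U' r))
    (fun V v => v \in [set v in U' | v \notin V]) (fun _ _ => 1)) /=.
  rewrite -sumr_const mulr_suml; apply: eq_bigr => V.
  rewrite inE => /andP[/andP[_ sVU'] /eqP <-].
  by rewrite mul1r -card_setD_vspace // -sumr_const.
have := countP U sWU.
rewrite (partition_big (fun p => p.1 + <[p.2]>)%VS (mem (subspaces_between W U r.+1))) /=; last first.
  case=> V v; rewrite /P !inE /= => /andP[/andP[/andP[sWV sVU] /eqP dV] /andP[vU vV]].
  rewrite (subv_trans sWV (addvSl _ _)) subv_add sVU -memvE vU /=.
  by rewrite dim_add_vline // dV addnS.
have fiber V' : V' \in subspaces_between W U r.+1 ->
   \sum_(p | P p U && (p.1 + <[p.2]> == V')%VS) 1 =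
   qbinom q r.+1 r * (q ^+ (\dim W + r.+1) - q ^+ (\dim W + r)).
  rewrite inE => /andP[/andP[sWV' sV'U] /eqP dV'].
  have := countP _ sWV'; rewrite dV' addKn => <-.
  apply: eq_bigl => -[V v]; rewrite /P !inE /=.
  apply/idP/idP => [/andP[/andP[/andP[/andP[sWV _] dV] /andP[vU vV]] /eqP <-]|].
    by rewrite sWV addvSl dV memvE addvSr vV.
  case/andP=> /andP[/andP[sWV sVV'] dV] /andP[vV' vV].
  rewrite sWV dV (subv_trans sVV') //= (subvP sV'U) //= vV /=.
  by rewrite eqEdim subv_add sVV' -memvE vV' /= dV' dim_add_vline // (eqP dV) addnS.
rewrite (eq_bigr _ fiber) sumr_const -[X in X = _]mulr_natl qbinomSn // => defN.
have q0 : q != 0 by rewrite pnatr_eq0 -lt0n ltnW // card_finNzRing_gt1.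
have nz := qexpr_sub1_neq0 card_field_gt1 r.
have nz1 := qexpr_sub1_neq0 card_field_gt1 0; rewrite expr1 in nz1.
have {defN} defN : #|subspaces_between W U r.+1|%:R * (q ^+ r.+1 - 1) * q ^+ (\dim W + r) =
   qbinom q (\dim U - \dim W) r * (q ^+ \dim U - q ^+ (\dim W + r)).
  rewrite -defN addnS (exprS _ (_ + r)).
  set N := #|subspaces_between _ _ _|%:R.
  by move: (q) (q ^+ (_ + r)) (q ^+ r.+1) N nz1 => Q X Y N nzQ; field.
have [ler|ltr] := leqP r (\dim U - \dim W); last first.
  rewrite (qbinom_small _ ltr) mul0r in defN; rewrite (qbinom_small _ (leqW ltr)).
  by move/eqP: defN; rewrite !mulf_eq0 expf_eq0 (negPf nz) (negPf q0) andbF !orbF => /eqP.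
have sdim := dimvS sWU.
have eqd : (\dim U = (\dim U - \dim W - r) + (\dim W + r))%N by lia.
rewrite {2}eqd [q ^+ (_ - _ + _)]exprD in defN.
have q0' : q ^+ (\dim W + r) != 0 by rewrite expf_neq0.
apply: (mulIf q0'); apply: (mulIf nz); rewrite mulrAC defN qbinomS.
set X := q ^+ (_ + _); set Y := q ^+ (_ - _); set Z := qbinom _ _ _.
by move: (q ^+ r.+1) X Y Z nz => Q X Y Z nz; field.
Qed.

End Interval.

(** * Whitney numbers as weighted counts of codes *)

Section WhitneyCodes.
Variables (F : finFieldType) (n d : nat).
Implicit Types U V W : {vspace 'rV[F]_n}.
Local Notation q := (#|F|%:R : rat).

(** The zero code counts as having minimum distance greater than every [d]. *)
Definition mindist_gt W : bool :=
  [forall v, (v \in W) && (hamming_weight v <= d)%N ==> (v == 0)].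

(** A spanning family of light vectors contains a basis, so membership in the
    lattice does not require linear independence. *)
Lemma span_in_dowling (X : seq 'rV[F]_n) :
  all (fun v => hamming_weight v <= d)%N X -> in_dowling d <<X>>%VS.
Proof.
move=> wtX; have [b [/allP sbX freeb spanb]] :
    exists b, [/\ all (mem X) b, free b & <<b>>%VS = <<X>>%VS].
  elim: X {wtX} => [|x X [b [sbX freeb spanb]]]; first by exists [::]; rewrite nil_free.
  have sbxX : all (mem (x :: X)) b.
    by apply/allP=> y /(allP sbX) yX; rewrite !inE; apply/orP; right.
  have [xX|xX] := boolP (x \in <<X>>%VS).
    by exists b; rewrite span_cons (addv_idPr _) -?memvE // -spanb.
  exists (x :: b); split; first by rewrite /= !inE eqxx.
    by rewrite free_cons spanb xX.
  by rewrite !span_cons spanb.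
have sizeb : size b == \dim <<X>>%VS by rewrite -spanb eq_sym.
rewrite /in_dowling; apply/orP; right; apply/existsP; exists (Tuple sizeb) => /=.
by rewrite basisEfree freeb spanb subvv (eqP sizeb) leqnn; apply/allP=> v /sbX /(allP wtX).
Qed.

Lemma dowling_spanned (D : dowling F n d) :
  exists2 X : seq 'rV[F]_n, all (fun v => hamming_weight v <= d)%N X & <<X>>%VS = D.
Proof.
case: D => U /= /orP[/eqP->|/existsP[b /andP[/span_basis spanb wtb]]].
  by exists [::]; rewrite ?span_nil.
by exists (val b).
Qed.

(** The largest member of the Dowling lattice contained in [W]. *)
Definition light_core W : {vspace 'rV[F]_n} :=
  <<[seq v <- enum 'rV[F]_n | (v \in W) && (hamming_weight v <= d)%N]>>%VS.

Lemma light_core_dowling W : in_dowling d (light_core W).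
Proof.
by apply: span_in_dowling; apply/allP=> v; rewrite mem_filter => /andP[/andP[]].
Qed.

Lemma dowling_sub_core W (D : dowling F n d) : (D <= W)%VS = (D <= light_core W)%VS.
Proof.
apply/idP/idP => [sDW|sDC]; last first.
  apply: (subv_trans sDC); apply/span_subvP=> v.
  by rewrite mem_filter => /andP[/andP[]].
have [X wtX defD] := dowling_spanned D; rewrite -defD in sDW *.
apply/span_subvP=> v vX; apply: memv_span.
have /= wtv := allP wtX v vX.
by rewrite mem_filter mem_enum (span_subvP sDW v vX) wtv.
Qed.

Lemma light_core_eq0 W : (light_core W == 0%VS) = mindist_gt W.
Proof.
apply/eqP/forallP => [core0 v|good].
  apply/implyP=> wt; rewrite -memv0 -core0 memv_span //.
  by rewrite mem_filter mem_enum wt.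
apply/eqP; rewrite -subv0; apply/span_subvP=> v; rewrite mem_filter memv0.
by case/andP=> wt _; exact: implyP (good v) wt.
Qed.

(** The sum ranges over the lower interval below the light core of [W], so by
    the recursion defining [mobius] it vanishes unless that core is zero. *)
Lemma sum_mobius_dowling W :
  \sum_(D : dowling F n d | (D <= W)%VS) mobius (dowling0 F n d) D = (mindist_gt W)%:R.
Proof.
pose C := Dowling (light_core_dowling W).
rewrite (eq_bigl _ _ (dowling_sub_core W)) -light_core_eq0.
rewrite (bigD1 C) ?subvv //= addrC.
have -> : (light_core W == 0%VS) = (dowling0 F n d == C) by rewrite eq_sym.
have [defC|neq] := eqVneq (dowling0 F n d) C.
  rewrite -defC mobiusxx big1 ?add0r // => D /andP[].
  by rewrite -[light_core W]/(dowling_space C) -defC subv0 => /eqP D0 /eqP[]; exact: val_inj.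
rewrite (mobius_neq neq) (eq_bigl (fun D => dowling0 F n d <= D < C)%O) ?subrr // => D.
by rewrite lt_neqAle [(_ <= D)%O]sub0v andbC.
Qed.

(** The Moebius function of the Dowling lattice, extended by zero to all
    subspaces; the sum has at most one term. *)
Definition dowling_mass U : rat :=
  (\sum_(D : dowling F n d | dowling_space D == U) mobius (dowling0 F n d) D)%:~R.

Lemma sum_dowling_mass (P : pred {vspace 'rV[F]_n}) :
  \sum_(U | P U) dowling_mass U =
  (\sum_(D : dowling F n d | P (dowling_space D)) mobius (dowling0 F n d) D)%:~R.
Proof.
rewrite [in RHS](partition_big (@dowling_space F n d) P) // rmorph_sum /=.
apply: eq_bigr => U PU; congr (_%:~R); apply: eq_bigl => D.
by case: eqP => [->|]; rewrite ?PU ?andbF.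
Qed.

Lemma sum_interval (W U : {vspace 'rV[F]_n}) (f : nat -> rat) : (W <= U)%VS ->
  \sum_(V | (W <= V <= U)%VS) f (\dim V - \dim W)%N =
  \sum_(r < n.+1) f r * qbinom q (\dim U - \dim W) r.
Proof.
move=> sWU; have lt V : (\dim V - \dim W < n.+1)%N.
  by rewrite ltnS (leq_trans (leq_subr _ _)) // dim_rV_le.
rewrite (partition_big (fun V => Ordinal (lt V)) xpredT) //=.
apply: eq_bigr => r _; rewrite -card_subspaces_between //.
rewrite (eq_bigr (fun=> f r)) => [|V /andP[_ /eqP<-]] //.
rewrite sumr_const mulr_natr; congr (_ *+ _); apply: eq_card => V.
rewrite !inE unfold_in /=; case: (boolP (W <= V)%VS) => //= /dimvS le; congr (_ && _).
by rewrite -val_eqE /= -(eqn_add2l (\dim W)) subnKC.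
Qed.

(** Moebius inversion over all subspaces.  By orthogonality the right-hand side
    has the same sum over the subspaces of every [U] as [dowling_mass], and
    functions with equal sums agree, by induction on the dimension. *)
Lemma dowling_massE U : dowling_mass U =
  \sum_(W | (W <= U)%VS && mindist_gt W) mobius_coef q (\dim U - \dim W)%N.
Proof.
have q1 := card_field_gt1 F.
have [m] := ubnP (\dim U); elim: m U => // m IHm U ltUm.
pose mass V := \sum_(W | (W <= V)%VS && mindist_gt W) mobius_coef q (\dim V - \dim W)%N.
have sum_mass : \sum_(V | (V <= U)%VS) mass V = (mindist_gt U)%:R.
  rewrite (exchange_big_dep (fun W => (W <= U)%VS && mindist_gt W)) /=; last first.
    by move=> V W sVU /andP[sWV ->]; rewrite (subv_trans sWV).
  transitivity (\sum_(W | (W <= U)%VS && mindist_gt W) (W == U)%:R : rat).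
    apply: eq_bigr => W /andP[sWU gW].
    under eq_bigl => V do rewrite gW andbT andbC.
    rewrite (sum_interval (mobius_coef q)) // sum_mobius_coef //; last first.
      by rewrite (leq_trans (leq_subr _ _)) // dim_rV_le.
    by rewrite subn_eq0 eqEdim sWU.
  have [gU|gU] := boolP (mindist_gt U).
    rewrite (bigD1 U) ?subvv ?gU //= eqxx big1 ?addr0 // => W /andP[_ /negPf->] //.
  by rewrite big1 // => W /andP[_ gW]; case: eqP gU => // <-; rewrite gW.
have := sum_dowling_mass (fun V => V <= U)%VS; rewrite sum_mobius_dowling.
rewrite (_ : _%:~R = (mindist_gt U)%:R); last by case: mindist_gt.
rewrite -sum_mass (bigD1 U) ?subvv // [in RHS](bigD1 U) ?subvv //=.
rewrite [X in _ + X = _](eq_bigr mass) => [/addIr//|V /andP[sVU neVU]].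
have ltVU : (\dim V < \dim U)%N by rewrite ltn_neqAle dimvS // (dimv_leqif_eq sVU) neVU.
by apply: IHm; apply: leq_trans ltVU _.
Qed.

(** After inversion, each code [W] contributes the same amount to every
    [i]-dimensional space above it, and the number of these is a q-binomial. *)
Lemma whitney_codes i :
  (whitney F n d i)%:~R = \sum_(W : {vspace 'rV[F]_n} | mindist_gt W && (\dim W <= i)%N)
    mobius_coef q (i - \dim W) * qbinom q (n - \dim W) (i - \dim W).
Proof.
rewrite /whitney -(sum_dowling_mass (fun U => \dim U == i)).
under eq_bigr do rewrite dowling_massE.
rewrite (exchange_big_dep (fun W => mindist_gt W && (\dim W <= i)%N)) /=; last first.
  by move=> U W /eqP<- /andP[/dimvS-> ->].
apply: eq_bigr => W /andP[gW leWi].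
rewrite (eq_bigr (fun=> mobius_coef q (i - \dim W))) => [|U /andP[/eqP-> //]].
rewrite sumr_const -[LHS]mulr_natr.
have := card_subspaces_between (i - \dim W) (subvf W); rewrite dim_fullrV => <-.
congr (_ * _%:R); apply: eq_card => U.
by rewrite !inE unfold_in /= gW andbT subvf andbT subnKC // andbC.
Qed.

End WhitneyCodes.

(** * Codes with large minimum distance *)

Section Codes.
Variables (F : finFieldType) (n : nat).
Implicit Types (u v w : 'rV[F]_n) (W : {vspace 'rV[F]_n}).
Local Notation q := (#|F|%:R : rat).

(** A codeword vanishing on [n - d] fixed coordinates has weight at most [d], so
    the projection of the code onto these coordinates is injective. *)
Lemma singleton_bound d W : (d <= n)%N -> mindist_gt d W -> (\dim W <= n - d)%N.
Proof.
move=> ledn /forallP good.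
pose g := widen_ord (leq_subr d n); pose f := linfun (colsub g : 'rV[F]_n -> 'rV[F]_(n - d)).
rewrite -(limg_ker_dim f W) (_ : (W :&: lker f)%VS = 0%VS) ?dimv0 ?dim_rV_le //.
apply/eqP; rewrite -subv0; apply/subvP=> v /memv_capP[vW]; rewrite memv_ker memv0 lfunE => /eqP v0.
apply: (implyP (good v)); rewrite vW /hamming_weight /=.
have sub : [set j | v 0 j != 0] \subset ~: [set g k | k : 'I_(n - d)].
  apply/subsetP=> j; rewrite !inE; apply: contra => /imsetP[k _ ->].
  by have := congr1 (fun M : 'rV_(n - d) => M 0 k) v0; rewrite !mxE => ->.
apply: leq_trans (subset_leq_card sub) _.
rewrite cardsCs setCK card_imset ?card_ord ?subKn //.
by move=> a b /(congr1 val) /= /val_inj.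
Qed.

Lemma hamming_weightZ k v : k != 0 -> hamming_weight (k *: v) = hamming_weight v.
Proof.
by move=> k0; apply: eq_card => j; rewrite !inE mxE mulf_eq0 (negPf k0).
Qed.

Lemma mindist_gt0v d : mindist_gt d (0%VS : {vspace 'rV[F]_n}).
Proof. by apply/forallP=> v; apply/implyP; rewrite memv0 => /andP[]. Qed.

Lemma mindist_gt_line d v : v != 0 -> mindist_gt d <[v]>%VS = (d < hamming_weight v)%N.
Proof.
move=> v0; apply/forallP/idP => [/(_ v)|ltdv w].
  by rewrite memv_line (negPf v0) implybF /= -ltnNge.
apply/implyP=> /andP[/vlineP[k ->]]; apply: contraLR.
rewrite scaler_eq0 negb_or => /andP[k0 _].
by rewrite hamming_weightZ // -ltnNge.
Qed.

(** The nonzero vectors of a line all have the same weight, so each vector of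
    weight above [d] lies on exactly one of these lines, as one of the [q - 1]
    nonzero vectors of it. *)
Lemma card_good_lines d :
  #|[set W : {vspace 'rV[F]_n} | mindist_gt d W && (\dim W == 1%N)]|%:R * (q - 1) =
  #|[set v : 'rV[F]_n | (d < hamming_weight v)%N]|%:R.
Proof.
have nz v : (d < hamming_weight v)%N -> v != 0.
  apply: contraTneq => ->; rewrite -leqNgt /hamming_weight.
  by rewrite (_ : [set _ | _] = set0) ?cards0 //; apply/setP=> j; rewrite !inE mxE eqxx.
rewrite -[in RHS]sum1_card natr_sum -sumr_const mulr_suml.
rewrite [RHS](partition_big (fun v => <[v]>%VS)
  (mem [set W : {vspace 'rV[F]_n} | mindist_gt d W && (\dim W == 1%N)])) /=; last first.
  by move=> v; rewrite !inE => wtv; rewrite dim_vline mindist_gt_line nz ?wtv.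
apply: eq_bigr => W; rewrite inE => /andP[gW /eqP dW].
rewrite mul1r; have := card_setD_vspace (sub0v W); rewrite dW dimv0 expr1 => <-.
rewrite -sum1_card natr_sum; apply: eq_bigl => v; rewrite !inE memv0.
apply/andP/andP => [[vW v0]|[wtv /eqP<-]]; last by rewrite memv_line nz.
have defW : <[v]>%VS = W by apply/eqP; rewrite eqEdim -memvE vW dW dim_vline v0.
by rewrite -mindist_gt_line // defW gW eqxx.
Qed.

Lemma card_hamming_sphere k :
  #|[set v : 'rV[F]_n | hamming_weight v == k]| = ('C(n, k) * (#|F| - 1) ^ k)%N.
Proof.
rewrite -sum1_card -(card_ord n) -card_draws -sum_nat_const card_ord.
rewrite (partition_big (fun v => [set j | v 0 j != 0]) (mem [set D : {set 'I_n} | #|D| == k])) /=.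
  2: by move=> v; rewrite !inE.
apply: eq_bigr => D; rewrite inE => /eqP cD.
have -> : (#|F| - 1)%N = #|predC1 (0 : F)| by rewrite cardC1 subn1.
rewrite -cD -(card_pffun_on 0) sum1_card.
pose h (f : {ffun 'I_n -> F}) := \row_j f j : 'rV[F]_n.
have injh : injective h.
  by move=> f g /rowP eqfg; apply/ffunP=> j; have := eqfg j; rewrite !mxE.
rewrite -(card_imset _ injh); apply: eq_card => v; rewrite unfold_in /= inE.
apply/andP/imsetP => [[_ /eqP defD]|[f /pffun_onP[/subsetP sf fD] ->]].
  exists [ffun j => v 0 j]; last by apply/rowP=> j; rewrite mxE ffunE.
  apply/pffun_onP; split; first by apply/subsetP=> j; rewrite -defD !inE ffunE.
  by move=> _ /imageP[j jD ->]; rewrite !inE ffunE; rewrite -defD inE in jD.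
have eqD : [set j | h f 0 j != 0] = D.
  apply/setP=> j; rewrite inE mxE; apply/idP/idP => [/sf //|jD].
  by apply: fD; apply/imageP; exists j.
by rewrite eqD /hamming_weight eqD cD !eqxx.
Qed.

(** These are the vectors of weight [n] and [n - 1]. *)
Lemma card_heavy_vectors : (1 < n)%N ->
  #|[set v : 'rV[F]_n | (n - 2 < hamming_weight v)%N]|%:R =
  (q - 1) ^+ n + n%:R * (q - 1) ^+ (n - 1) :> rat.
Proof.
move=> n1; have sphere k : #|[set v : 'rV[F]_n | hamming_weight v == k]|%:R =
    'C(n, k)%:R * (q - 1) ^+ k :> rat.
  by rewrite card_hamming_sphere natrM natrX natrB // ltnW ?card_finNzRing_gt1.
have := sphere n; rewrite binn mul1r => <-.
have := sphere (n - 1)%N; rewrite -bin_sub ?leq_subr // subKn ?(ltnW n1) // bin1 => <-.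
rewrite -natrD -cardsUI (_ : _ :&: _ = set0) ?cards0 ?addn0.
  congr (_%:R); apply: eq_card => v; rewrite !inE.
  have : (hamming_weight v <= n)%N by rewrite -[X in (_ <= X)%N]card_ord max_card.
  by move: (hamming_weight v) => w; lia.
apply/setP=> v; rewrite !inE; apply/negP=> /andP[/eqP->]; lia.
Qed.

(** A vector has weight at most [n - 2] exactly when it has two zeros. *)
Lemma mindist_gtP W : (1 < n)%N ->
  reflect (forall w i j, w \in W -> i != j -> w 0 i = 0 -> w 0 j = 0 -> w = 0)
          (mindist_gt (n - 2) W).
Proof.
move=> n1; apply: (iffP forallP) => [good w i j wW ij wi wj|good w].
  apply/eqP; apply: (implyP (good w)); rewrite wW /= /hamming_weight.
  have sub : [set k | w 0 k != 0] \subset ~: [set i; j].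
    by apply/subsetP=> k; rewrite !inE; apply: contra => /orP[] /eqP->; apply/eqP.
  apply: leq_trans (subset_leq_card sub) _.
  by rewrite cardsCs setCK card_ord cards2 ij.
apply/implyP=> /andP[wW]; rewrite /hamming_weight => wt.
have : (1 < #|[set k | w 0%R k == 0%R]|)%N.
  have -> : [set k | w 0 k == 0] = ~: [set k | w 0 k != 0].
    by apply/setP=> k; rewrite !inE negbK.
  by rewrite cardsCs setCK card_ord; apply: leq_trans (leq_sub2l n wt); rewrite subKn.
case/card_gt1P=> i [j []]; rewrite !inE => /eqP wi /eqP wj ij.
by apply/eqP; exact: good ij wi wj.
Qed.

(** The 2 x 2 minors of the matrix with rows [p.1] and [p.2]: its columns are
    pairwise independent. *)
Definition minors_neq0 (p : 'rV[F]_n * 'rV[F]_n) : bool :=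
  [forall i, forall j, (i != j) ==> (p.1 0 i * p.2 0 j - p.1 0 j * p.2 0 i != 0)].

Lemma minors_neq0P (p : 'rV[F]_n * 'rV[F]_n) :
  reflect (forall i j, i != j -> p.1 0 i * p.2 0 j - p.1 0 j * p.2 0 i <> 0) (minors_neq0 p).
Proof.
apply: (iffP forallP) => [H i j ij|H i].
  by apply/eqP; have /forallP/(_ j)/implyP := H i; apply.
by apply/forallP=> j; apply/implyP=> ij; apply/eqP/H.
Qed.

(** A vanishing minor at columns [i], [j] is a nontrivial combination of the two
    rows that is zero at [i] and at [j]. *)
Lemma minors_neq0_plane u v : (1 < n)%N ->
  minors_neq0 (u, v) =
  [&& u != 0, v \notin <[u]>%VS & mindist_gt (n - 2) (<[u]> + <[v]>)%VS].
Proof.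
move=> n1; apply/minors_neq0P/and3P => [nz|[u0 vu /(mindist_gtP _ n1) good] i j ij] /=.
  have [i [j ij]] : exists i j : 'I_n, i != j.
    by exists (Ordinal (ltnW n1)), (Ordinal n1).
  split.
  - by apply/eqP=> u0; case: (nz i j ij); rewrite /= u0 !mxE; ring.
  - by apply/vlineP=> -[k vk]; case: (nz i j ij); rewrite /= vk !mxE; ring.
  apply/mindist_gtP=> // w a b /memv_addP[_ /vlineP[x ->] [_ /vlineP[y ->] ->]] ab.
  rewrite !mxE => wa wb; have /= nzab := nz a b ab.
  have x0 : x = 0.
    apply: (mulIf (introN eqP nzab)); rewrite mul0r.
    have -> : x * (u 0 a * v 0 b - u 0 b * v 0 a) =
      (x * u 0 a + y * v 0 a) * v 0 b - (x * u 0 b + y * v 0 b) * v 0 a by ring.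
    by rewrite wa wb; ring.
  have y0 : y = 0.
    apply: (mulIf (introN eqP nzab)); rewrite mul0r.
    have -> : y * (u 0 a * v 0 b - u 0 b * v 0 a) =
      (x * u 0 b + y * v 0 b) * u 0 a - (x * u 0 a + y * v 0 a) * u 0 b by ring.
    by rewrite wa wb; ring.
  by rewrite x0 y0 !scale0r addr0.
move=> det0.
(* Only the trivial combination of the rows is zero at i and j (vanish).
   The entries of column i are the coefficients of such a combination, because
   the minor is zero; so column i is zero, then likewise column j, and then
   every combination of the rows is zero at i and j: a contradiction. *)
have free2 x y : x *: u - y *: v = 0 -> (x == 0) && (y == 0).
  move=> rel; have y0 : y = 0.
    apply: contraNeq vu => y0; apply/vlineP; exists (y^-1 * x).
    by rewrite -scalerA (subr0_eq rel) scalerA mulVf ?scale1r.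
  by move: rel; rewrite y0 scale0r subr0 => /eqP; rewrite scaler_eq0 (negPf u0) orbF => ->; rewrite eqxx.
have vanish x y : x * u 0 i - y * v 0 i = 0 -> x * u 0 j - y * v 0 j = 0 ->
    (x == 0) && (y == 0).
  move=> ri rj; apply: free2; apply: (good _ i j _ ij); rewrite ?mxE //.
  by rewrite memv_add // ?rpredN memvZ ?memv_line.
have /andP[/eqP vi /eqP ui] : (v 0 i == 0) && (u 0 i == 0).
  apply: vanish; first by ring.
  by rewrite -[RHS]oppr0 -[in RHS]det0; ring.
have /andP[/eqP vj /eqP uj] : (v 0 j == 0) && (u 0 j == 0).
  by apply: vanish; rewrite ?ui ?vi; ring.
have /andP[] : (1 == 0 :> F) && (0 == 0 :> F) by apply: vanish; rewrite ?ui ?uj ?vi ?vj; ring.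
by rewrite oner_eq0.
Qed.

(** The factor multiplying the number of planes is the number of ordered bases of
    a plane. *)
Lemma card_good_planes_bases : (1 < n)%N ->
  #|[set W : {vspace 'rV[F]_n} | mindist_gt (n - 2) W && (\dim W == 2)]|%:R * ((q ^+ 2 - 1) * (q ^+ 2 - q)) =
  #|[set p : 'rV[F]_n * 'rV[F]_n | minors_neq0 p]|%:R.
Proof.
move=> n1.
rewrite -[in RHS]sum1_card natr_sum -sumr_const mulr_suml.
rewrite [RHS](partition_big (fun p => <[p.1]> + <[p.2]>)%VS
  (mem [set W : {vspace 'rV[F]_n} | mindist_gt (n - 2) W && (\dim W == 2)])) /=; last first.
  case=> u v; rewrite !inE minors_neq0_plane //= => /and3P[u0 vu ->].
  by rewrite dim_add_vline // dim_vline u0.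
apply: eq_bigr => W; rewrite inE => /andP[gW /eqP dW]; rewrite mul1r.
transitivity (\sum_(u in [set u in W | u \notin 0%VS])
   \sum_(v in [set v in W | v \notin <[u]>%VS]) (1 : rat)).
  have := card_setD_vspace (sub0v W); rewrite dW dimv0 expr0 => <-.
  rewrite -sumr_const mulr_suml; apply: eq_bigr => u; rewrite inE memv0 => /andP[uW u0].
  by rewrite sumr_const card_setD_vspace -?memvE // dW dim_vline u0 mul1r.
rewrite pair_big_dep /=; apply: eq_bigl => -[u v].
rewrite !inE minors_neq0_plane //= memv0.
apply/idP/idP => [/andP[/andP[uW u0] /andP[vW vu]]|/andP[/and3P[-> -> _] /eqP<-]]; last first.
  by rewrite !memvE addvSl addvSr.
have defW : (<[u]> + <[v]>)%VS = W.
  by apply/eqP; rewrite eqEdim subv_add -!memvE uW vW dW dim_add_vline // dim_vline u0.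
by rewrite defW u0 vu gW eqxx.
Qed.

(** Every nonzero column is a unique nonzero multiple of a column (1, s) or
    (0, 1), and two columns are independent when these normalised forms differ.
    The latter are the points of the projective line, encoded as [option F]. *)
Lemma card_minors_neq0 : (1 < n)%N ->
  #|[set p : 'rV[F]_n * 'rV[F]_n | minors_neq0 p]| = ((#|F| - 1) ^ n * (#|F| + 1) ^_ n)%N.
Proof.
move=> n1.
(* mk (h p) = p for every p, while h (mk (c, z)) = (c, z) only if c has no
   zero entry, which pairwise independent columns ensure. *)
pose col (z : option F) : F * F := if z is Some s then (1, s) else (0, 1).
pose mk (cp : {ffun 'I_n -> F} * {ffun 'I_n -> option F}) : 'rV[F]_n * 'rV[F]_n :=
  (\row_j (cp.1 j * (col (cp.2 j)).1), \row_j (cp.1 j * (col (cp.2 j)).2)).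
pose h (p : 'rV[F]_n * 'rV[F]_n) :=
  ([ffun j => if p.1 0 j == 0 then p.2 0 j else p.1 0 j],
   [ffun j => if p.1 0 j == 0 then None else Some (p.2 0 j / p.1 0 j)]).
pose A := setX [set c : {ffun 'I_n -> F} in ffun_on (predC1 0)]
  [set z : {ffun 'I_n -> option F} | injectiveb z].
have -> : ((#|F| - 1) ^ n * (#|F| + 1) ^_ n)%N = #|A|.
  by rewrite cardsX cardsE card_ffun_on card_inj_ffuns cardC1 card_option card_ord subn1 addn1.
rewrite -!sum1_card (reindex_onto mk h) /=; last first.
  case=> u v _; rewrite /mk /h; congr (_, _); apply/rowP=> j; rewrite mxE !ffunE /=.
    by have [->|u0] /= := eqVneq (u 0 j) 0; rewrite ?mulr0 ?mulr1.
  by have [u0|u0] /= := eqVneq (u 0 j) 0; rewrite ?mulr1 // mulrC divfK.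
apply: eq_bigl => -[c z]; rewrite !inE /=.
have detE i j : (mk (c, z)).1 0 i * (mk (c, z)).2 0 j - (mk (c, z)).1 0 j * (mk (c, z)).2 0 i =
    c i * c j * ((col (z i)).1 * (col (z j)).2 - (col (z j)).1 * (col (z i)).2).
  by rewrite !mxE /=; ring.
have det0 y t : ((col y).1 * (col t).2 - (col t).1 * (col y).2 == 0) = (y == t).
  case: y t => [s|] [t|] /=; rewrite ?mul0r ?mul1r ?mulr1 ?subr0 ?sub0r ?oppr_eq0 ?oner_eq0 ?eqxx //.
  by rewrite subr_eq0 eq_sym.
apply/andP/andP => [[/minors_neq0P nz _]|[/ffun_onP c0 /injectiveP injz]].
  have c0 j : c j != 0.
    have [i ij] : exists i : 'I_n, i != j.
      have [->|] := eqVneq j (Ordinal n1); first by exists (Ordinal (ltnW n1)).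
      by move=> ?; exists (Ordinal n1); rewrite eq_sym.
    by apply/eqP=> cj; apply: (nz i j ij); rewrite detE cj mulr0 mul0r.
  split; first by apply/ffun_onP=> j; rewrite !inE.
  apply/injectiveP=> i j eqz; apply/eqP; apply: contraT => ij.
  by case: (nz i j ij); rewrite detE eqz subrr mulr0.
split.
  apply/minors_neq0P=> i j ij; apply/eqP; rewrite detE !mulf_eq0 det0 !negb_or.
  by have := (c0 i, c0 j); rewrite !inE => -[-> ->] /=; rewrite (inj_eq injz).
apply/eqP; congr (_, _); apply/ffunP=> j; rewrite ffunE !mxE /=.
  case: (z j) => [s|] /=; rewrite ?mulr1 ?mulr0 ?eqxx //.
  by have := c0 j; rewrite !inE => /negPf->.
have := c0 j; rewrite !inE => cj; case: (z j) => [s|] /=; rewrite ?mulr1 ?mulr0 ?eqxx //.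
by rewrite (negPf cj) mulrC mulKf.
Qed.

End Codes.

(** * The numbers of lines and planes, and the formula *)

Section Counts.
Variables (F : finFieldType) (n : nat) (n_ge3 : (3 <= n)%N).
Local Notation q := (#|F|%:R : rat).

Let n_gt1 : (1 < n)%N. Proof. exact: ltnW. Qed.
Let nz0 : q != 0.
Proof. by rewrite pnatr_eq0 -lt0n ltnW ?card_finNzRing_gt1. Qed.
Let nz1 : q - 1 != 0.
Proof. by have := qexpr_sub1_neq0 (card_field_gt1 F) 0; rewrite expr1. Qed.
Let nz2 : q + 1 != 0.
Proof. by rewrite gt_eqF // ltr_wpDl ?ler0n. Qed.

Lemma ffact_natr (a m : nat) : (a ^_ m)%:R = \prod_(j < m) (a%:R - j%:R) :> rat.
Proof.
elim: m => [|m IHm]; first by rewrite big_ord0.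
rewrite big_ord_recr /= -IHm ffactnSr natrM.
have [lema|ltam] := leqP m a; first by rewrite natrB.
by rewrite ffact_small // !mul0r.
Qed.

Lemma count_good_lines :
  #|[set W : {vspace 'rV[F]_n} | mindist_gt (n - 2) W && (\dim W == 1)]|%:R =
  (q - 1) ^+ (n - 1) + n%:R * (q - 1) ^+ (n - 2).
Proof.
apply: (mulIf nz1); rewrite card_good_lines card_heavy_vectors //.
by rewrite mulrDl -mulrA -!exprSr; congr (_ ^+ _ + _ * _ ^+ _); lia.
Qed.

Lemma count_good_planes :
  #|[set W : {vspace 'rV[F]_n} | mindist_gt (n - 2) W && (\dim W == 2)]|%:R =
  (q - 1) ^+ (n - 1) * \prod_(2 <= j < n - 1) (q - j%:R).
Proof.
have nz : (q ^+ 2 - 1) * (q ^+ 2 - q) != 0.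
  have -> : (q ^+ 2 - 1) * (q ^+ 2 - q) = (q - 1) * (q - 1) * (q + 1) * q by ring.
  by rewrite !mulf_neq0.
apply: (mulIf nz); rewrite card_good_planes_bases // card_minors_neq0 //.
rewrite natrM natrX natrB ?ffact_natr; last by rewrite ltnW ?card_finNzRing_gt1.
have [m ->] : exists m, n = m.+3 by exists (n - 3)%N; lia.
have -> : \prod_(2 <= j < m.+3 - 1) (q - j%:R) = \prod_(j < m) (q - (j + 2)%:R).
  by rewrite -{1}[2%N]add0n big_addn subn1 subn2 big_mkord.
rewrite 3!big_ord_recl subn1 /=.
rewrite (eq_bigr (fun j : 'I_m => q - (j + 2)%:R)) => [|j _].
  by rewrite exprS /bump /=; ring.
by rewrite /bump /= !natrD; ring.
Qed.

End Counts.

Theorem theorem7p3 (F : finFieldType) (q : rat) (hq : q = #|F|%:R) (n i : nat)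
    (hn : (3 <= n)%N) (hi : (2 <= i <= n)%N) :
  (-1) ^+ i * (whitney F n (n - 2) i)%:~R =
    qbinom q n i * q ^+ 'C(i, 2)
    - ((q - 1) ^+ (n - 1) + n%:R * (q - 1) ^+ (n - 2))
        * qbinom q (n - 1) (i - 1) * q ^+ 'C(i - 1, 2)
    + ((q - 1) ^+ (n - 1) * \prod_(2 <= j < n - 1) (q - j%:R))
        * qbinom q (n - 2) (i - 2) * q ^+ 'C(i - 2, 2).
Proof.
have /andP[i2 _] := hi; rewrite hq whitney_codes -count_good_lines // -count_good_planes //.
set t := fun k => mobius_coef #|F|%:R (i - k) * qbinom #|F|%:R (n - k) (i - k).
pose good k := [set W : {vspace 'rV[F]_n} | mindist_gt (n - 2) W && (\dim W == k)].
have dim_le2 (W : {vspace 'rV[F]_n}) : mindist_gt (n - 2) W -> (\dim W < 3)%N.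
  by move/(singleton_bound (leq_subr 2 n)); rewrite subKn // ltnW.
(* Collect the codes by dimension; as i is at least 2, the condition
   dim W <= i holds for all of them. *)
have sum3 : \sum_(W : {vspace 'rV[F]_n} | mindist_gt (n - 2) W && (\dim W <= i)%N) t (\dim W)
    = \sum_(k < 3) #|good k|%:R * t k.
  rewrite (partition_big (fun W => inord (\dim W) : 'I_3) xpredT) //=.
  apply: eq_bigr => k _; rewrite mulr_natl -sumr_const.
  apply: eq_big => [W|W /andP[/andP[gW _] /eqP <-]]; last by rewrite inordK // dim_le2.
  rewrite inE; case: (boolP (mindist_gt _ W)) => //= gW; have dW := dim_le2 W gW.
  by rewrite -val_eqE /= inordK // (leq_trans _ i2).
rewrite sum3 !big_ord_recr big_ord0 /= add0r.
have -> : #|good 0%N| = 1%N.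
  rewrite (_ : good 0%N = [set 0%VS]) ?cards1 //; apply/setP=> W; rewrite !inE dimv_eq0.
  by case: eqP => [->|]; rewrite ?andbF // mindist_gt0v.
rewrite /t /mobius_coef !subn0.
have sign : (-1) ^+ (i - 1) = - (-1) ^+ (i - 2) :> rat.
  by rewrite (_ : i - 1 = (i - 2).+1)%N ?exprS ?mulN1r //; lia.
have sign2 : (-1) ^+ i = (-1) ^+ (i - 2) :> rat.
  by rewrite -(subnK i2) addnK exprD sqrrN expr1n mulr1.
rewrite sign sign2.
have : (-1) ^+ (i - 2) * (-1) ^+ (i - 2) = 1 :> rat by rewrite -expr2 sqrr_sign.
rewrite -/(good 1%N) -/(good 2%N).
move: ((-1) ^+ (i - 2)) => s ss.
set a := qbinom _ n i; set b := qbinom _ (n - 1) _; set c := qbinom _ (n - 2) _.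
set x := _ ^+ 'C(i, 2); set y := _ ^+ 'C(i - 1, 2); set z := _ ^+ 'C(i - 2, 2).
move: (#|good 1%N|%:R) (#|good 2%N|%:R) => A B.
transitivity (s * s * (a * x - A * b * y + B * c * z)); last by rewrite ss mul1r.
by ring.
Qed.
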